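(* Let $a,b\ge2$ be integers and let $\Gamma(a,b)=(V,E)$ with graph distance $d$. For $x\in\mathbb R$, the kernel $Q_x(u,v)=x^{d(u,v)}$ (with $0^0=1$) is positive semidefinite on $V$ if and only if $x\in\left[\frac{-1}{b-1},1\right]$.
   Context: $\Gamma(a,b)$ is the (unique up to isomorphism) infinite connected graph in which every block (maximal 2-connected subgraph) is a complete graph on $b$ vertices and every vertex lies in exactly $a$ blocks, i.e., $a$ copies of the complete graph $K_b$ are glued together at each vertex in a tree-like way (for $b=2$ this is the homogeneous tree of valency $a$). A kernel $Q$ on $V$ is positive semidefinite if $\sum_{i,j=1}^nc_i\bar c_jQ(u_i,u_j)\ge0$ for all $n$, $u_1,\dots,u_n\in V$, $c_1,\dots,c_n\in\mathbb C$. *)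

(* Defs.v *)
From mathcomp Require Export all_boot all_order all_algebra.
From mathcomp Require Export all_classical all_reals.
From mathcomp Require Export complex.

Set Implicit Arguments.
Unset Strict Implicit.
Unset Printing Implicit Defensive.

Import Order.TTheory GRing.Theory Num.Theory.
Local Open Scope classical_set_scope.
Local Open Scope card_scope.
Local Open Scope ring_scope.

Definition simple_graph (V : Type) (E : rel V) : Prop :=
  symmetric E /\ irreflexive E.

Definition walk (V : Type) (E : rel V) (u v : V) (n : nat) : Prop :=
  exists p : seq V, [/\ path E u p, last u p = v & size p = n].

(* The value 0 for u, v in different components is a junk value. *)
Definition gdist (V : Type) (E : rel V) (u v : V) : nat :=
  if pselect (exists n, `[< walk E u v n >]) is left h then ex_minn h else 0%N.

(* [V -> V -> bool] instead of [rel V]: the universe of [rel] would prevent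
   forming sets of subgraphs. *)
Record subgraph (V : Type) := Subgraph {
  sverts : set V;
  sadj : V -> V -> bool
}.

Definition is_subgraph (V : Type) (E : rel V) (H : subgraph V) : Prop :=
  symmetric (sadj H) /\
  forall u v, sadj H u v -> [/\ E u v, sverts H u & sverts H v].

Definition subgraph_le (V : Type) (H K : subgraph V) : Prop :=
  sverts H `<=` sverts K /\ (forall u v, sadj H u v -> sadj K u v).

Definition whole_graph (V : Type) (E : rel V) : subgraph V := Subgraph setT E.

Definition sconnected (V : Type) (H : subgraph V) : Prop :=
  forall u v, sverts H u -> sverts H v -> exists n, walk (sadj H) u v n.

Definition del_vertex (V : Type) (H : subgraph V) (w : V) : subgraph V :=
  Subgraph (sverts H `\ w)
    (fun u v => [&& sadj H u v, `[< u <> w >] & `[< v <> w >]]).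

(* 2-connectedness in the sense used for block decompositions: at least two
   vertices, connected, no cut vertex. In particular K_2 is 2-connected, so that
   the blocks of a tree are its edges. *)
Definition two_connected (V : Type) (H : subgraph V) : Prop :=
  [/\ exists u v, [/\ sverts H u, sverts H v & u <> v],
      sconnected H
    & forall w, sverts H w -> sconnected (del_vertex H w)].

Definition is_block (V : Type) (E : rel V) (H : subgraph V) : Prop :=
  [/\ is_subgraph E H, two_connected H
    & forall K, is_subgraph E K -> two_connected K ->
        subgraph_le H K -> K = H].

Definition complete_on (V : Type) (b : nat) (H : subgraph V) : Prop :=
  sverts H #= `I_b /\
  forall u v, sverts H u -> sverts H v -> u <> v -> sadj H u v.

(* (V, E) is a realization of Gamma(a, b), which is determined by these
   properties up to isomorphism. *)
Definition is_Gamma (a b : nat) (V : Type) (E : rel V) : Prop :=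
  [/\ simple_graph E,
      infinite_set [set: V],
      sconnected (whole_graph E),
      forall H, is_block E H -> complete_on b H
    & forall v, [set H : subgraph V | is_block E H /\ sverts H v] #= `I_a].

Definition psd_kernel (R : realType) (V : Type) (Q : V -> V -> R[i]) : Prop :=
  forall (n : nat) (u : 'I_n -> V) (c : 'I_n -> R[i]),
    0 <= \sum_(i < n) \sum_(j < n) c i * (c j)^* * Q (u i) (u j).

(* Main.v *)
Require Import Defs.
From mathcomp Require Import all_boot all_order all_algebra.
From mathcomp Require Import all_classical all_reals.
From mathcomp Require Import complex.
From mathcomp Require Import zify ring lra.

Set Implicit Arguments.
Unset Strict Implicit.
Unset Printing Implicit Defensive.

Import Order.TTheory GRing.Theory Num.Theory.
Local Open Scope ring_scope.
Local Open Scope complex_scope.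

(** A cycle of Gamma(a,b) is two-connected, hence lies in a block and spans a
    clique.  So two neighbours of [w] joined by a walk avoiding [w] are adjacent,
    and, after rooting the graph at [o], this forces every vertex to have a
    unique parent and [d u v = 1 + d (parent u) v] whenever [v] is not deeper
    than [u] and is not a sibling of [u] (same depth, adjacent).

    Let [Q_N] be the kernel restricted to depth at most [N].  Replacing each
    vertex [u] of depth [N+1] by [x] times its parent changes the quadratic form
    of [Q_{N+1}] into that of [Q_N], up to the kernel
    [(1 - x) * ([u = v] + x * [u, v siblings])] on the vertices of depth [N+1].
    A sibling class has at most [b - 1] elements, so this kernel is positive
    semidefinite as soon as [-1/(b-1) <= x <= 1].  Conversely, a single block
    gives the two bounds, through the vectors [(1,...,1)] and [(1,-1)]. *)

(** * Finite sets as duplicate-free lists *)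

Lemma card_II_seq (V : choiceType) (A : set V) (n : nat) : (A #= `I_n)%card ->
  exists s : seq V, [/\ uniq s, size s = n & forall v, v \in s <-> A v].
Proof.
move=> cA; have fA : finite_set A by apply/finite_setP; exists n.
exists (finmap.enum_fset (fset_set A)); split.
- exact: finmap.fset_uniq.
- exact: card_fset_set cA.
- by move=> v; rewrite (in_fset_set fA) in_setE.
Qed.

(** * Walks and the relation of being joined by a walk *)

Section Walks.
Variables (V : Type) (e : rel V).

Definition linked (u v : V) : Prop := exists n, walk e u v n.

Lemma walk_cat u v w m n : walk e u v m -> walk e v w n -> walk e u w (m + n).
Proof.
move=> [p [ep lp sp]] [q [eq lq sq]]; exists (p ++ q).
by rewrite cat_path last_cat lp ep eq lq size_cat sp sq.
Qed.

Lemma walk_edge u v : e u v -> walk e u v 1.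
Proof. by move=> uv; exists [:: v]; rewrite /= uv. Qed.

Lemma walk_sym u v n : symmetric e -> walk e u v n -> walk e v u n.
Proof.
move=> sE [p [ep lp sp]]; exists (rev (belast u p)); split.
- have := rev_path e u p; rewrite lp => ->.
  by rewrite (eq_path (e' := e)) // => x y; rewrite sE.
- by case: p lp {ep sp} => [|x p] //= _; rewrite rev_cons last_rcons.
- by rewrite size_rev size_belast.
Qed.

Lemma linkedxx u : linked u u.
Proof. by exists 0%N, [::]. Qed.

Lemma linked_trans v u w : linked u v -> linked v w -> linked u w.
Proof. by move=> [m h] [n k]; exists (m + n)%N; apply: walk_cat k. Qed.

Lemma linked_sym u v : symmetric e -> linked u v -> linked v u.
Proof. by move=> sE [n h]; exists n; apply: walk_sym. Qed.

End Walks.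

Lemma sub_linked (V : Type) (e e' : rel V) u v :
  subrel e e' -> linked e u v -> linked e' u v.
Proof.
move=> ee' [n [p [ep lp sp]]]; exists n, p; split=> //; exact: sub_path ep.
Qed.

Lemma path_linked (V : eqType) (e : rel V) u p v :
  path e u p -> v \in u :: p -> linked e u v.
Proof.
elim: p u => [|w p IH] u /= ; first by rewrite inE => _ /eqP ->; apply: linkedxx.
move=> /andP[uw wp]; rewrite inE => /orP[/eqP->|/(IH _ wp)]; first exact: linkedxx.
by apply: linked_trans; exists 1%N; apply: walk_edge.
Qed.

Lemma del_vertex_sym (V : Type) (H : subgraph V) w :
  symmetric (sadj H) -> symmetric (sadj (del_vertex H w)).
Proof. by move=> sH u v /=; rewrite sH; congr (_ && _); rewrite andbC. Qed.

(** * Two-connected subgraphs, blocks and cycles *)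

Section Blocks.
Variables (V : choiceType) (E : rel V).

(* The union of all two-connected subgraphs through two given vertices is
   two-connected, because after deleting a vertex at least one of the two is
   still there to link everything. *)
Lemma two_connected_sub_block (K : subgraph V) : is_subgraph E K ->
  two_connected K -> exists2 H, is_block E H & subgraph_le K H.
Proof.
move=> sK tK; have [[u [v [Ku Kv uv]]] _ _] := tK.
pose good (L : subgraph V) :=
  [/\ is_subgraph E L, two_connected L, sverts L u & sverts L v].
have gK : good K by [].
pose B := Subgraph (fun w => exists2 L, good L & sverts L w)
  (fun s t => `[< exists2 L, good L & sadj L s t >]).
have leB L : good L -> subgraph_le L B.
  by move=> gL; split=> [w Lw|s t st]; [exists L|apply/asboolP; exists L].
have symB : symmetric (sadj B).
  move=> s t; apply/asboolP/asboolP => -[L gL st]; exists L => //;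
  by have [[-> _] _ _ _] := gL.
have sB : is_subgraph E B.
  split=> // s t /asboolP[L gL st]; have [[_ /(_ _ _ st)[est Ls Lt]] _ _ _] := gL.
  by split=> //; exists L.
have tB : two_connected B.
  split.
  - by exists u, v; split=> //; exists K.
  - have cu w : sverts B w -> linked (sadj B) w u.
      move=> [L gL Lw]; have [_ [_ cL _] Lu _] := gL.
      by apply: sub_linked (cL _ _ Lw Lu); apply: (leB L gL).2.
    move=> s t Bs Bt; apply: linked_trans (cu s Bs) _.
    by apply: linked_sym (cu t Bt).
  - move=> z Bz.
    have [r rz rL] : exists2 r, r <> z & forall L, good L -> sverts L r.
      have [uz|uz] := pselect (u = z); last by exists u => // L [].
      by exists v => [vz|L []//]; apply: uv; rewrite uz vz.
    have symD := del_vertex_sym z symB.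
    have cr w : sverts (del_vertex B z) w -> linked (sadj (del_vertex B z)) w r.
      move=> [[L gL Lw] /= wz]; have [sL [_ cL dL] _ _] := gL.
      have Lr := rL L gL.
      have [Lz|Lz] := pselect (sverts L z).
        apply: sub_linked (dL z Lz w r (conj Lw wz) (conj Lr rz)) => s t /=.
        by move=> /and3P[st ? ?]; apply/and3P; split=> //; exact: (leB L gL).2.
      apply: sub_linked (cL _ _ Lw Lr) => s t st /=.
      have [_ Ls Lt] := sL.2 _ _ st.
      apply/and3P; split; first exact: (leB L gL).2.
        by apply/asboolP => ez; apply: Lz; rewrite -ez.
      by apply/asboolP => ez; apply: Lz; rewrite -ez.
    move=> s t Bs Bt; apply: linked_trans (cr s Bs) _.
    by apply: linked_sym (cr t Bt).
exists B; last exact: leB.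
split=> // L sL tL BL.
(* Maximality: a two-connected subgraph above [B] still contains [u] and [v], so it is one of the
   subgraphs united in [B]. *)
have gL : good L by split=> //; apply: BL.1; exists K.
have LB := leB L gL.
case: L BL LB {sL tL gL} => Lv La [/= h1 h2] [/= h3 h4].
rewrite /B; congr Subgraph; first by apply/seteqP; split.
by apply/funext => s; apply/funext => t; apply/idP/idP => [/h4|/h2].
Qed.

Definition induced (s : seq V) : subgraph V :=
  Subgraph (fun v => v \in s) (fun u v => [&& E u v, u \in s & v \in s]).

Hypothesis symE : symmetric E.

(** The subgraph induced on a cycle is two-connected: rotated to start at a deleted vertex [w], the
    cycle leaves a path through all its other vertices. Length 2 is allowed and stands for a single
    edge. *)
Lemma cycle_sub_block (c : seq V) : cycle E c -> uniq c -> (2 <= size c)%N ->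
  exists2 H, is_block E H & forall v, v \in c -> sverts H v.
Proof.
move=> cyc uc sc.
have symI : symmetric (sadj (induced c)).
  by move=> s t /=; rewrite symE; congr (_ && _); rewrite andbC.
have sI : is_subgraph E (induced c) by split=> // s t /= /and3P[].
have conn (e : rel V) s : symmetric e -> sorted e s ->
    forall y z, y \in s -> z \in s -> linked e y z.
  case: s => // t s sE /= ets y z ys zs; apply: linked_trans (path_linked ets zs).
  by apply: linked_sym (path_linked ets ys).
have sub_in s : {subset s <= c} -> sorted E s -> sorted (sadj (induced c)) s.
  move=> sc' es; apply: (sub_in_sorted (P := mem c)) es; last by apply/allP.
  by move=> y z yc zc yz; apply/and3P.
have [|H bH leH] := @two_connected_sub_block _ sI; last first.
  by exists H => // v vc; apply: leH.1.
split.
- case: c uc sc {cyc symI sI sub_in} => [|u [|v c]] //= /andP[uvc _] _.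
  exists u, v; rewrite /= !inE !eqxx orbT; split=> // uv.
  by move: uvc; rewrite uv inE eqxx.
- move=> y z yc zc; apply: (conn _ c) => //; apply: sub_in => //.
  by case: (c) cyc => //= t s; rewrite rcons_path => /andP[].
- move=> w /= wc.
  have [i c' ec] := rot_to wc.
  have mc v : (v \in c) = (v \in w :: c') by rewrite -ec mem_rot.
  have /andP[wc' uc'] : uniq (w :: c') by rewrite -ec rot_uniq.
  have /= cyc' : cycle E (w :: c') by rewrite -ec rot_cycle.
  have ec' : sorted E c'.
    by move: cyc'; rewrite rcons_path => /andP[/path_sorted].
  move=> y z [yc yw] [zc zw]; apply: (conn _ c').
  + exact: del_vertex_sym.
  + apply: (sub_in_sorted (P := mem c')) ec'; last exact/allP.
    move=> s t sc' tc' /= st; rewrite st !mc !inE sc' tc' !orbT /=.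
    by apply/andP; split; apply/asboolP=> ew; move: wc'; rewrite -ew ?sc' ?tc'.
  + by move: yc; rewrite /= mc inE => /orP[/eqP/yw|].
  + by move: zc; rewrite /= mc inE => /orP[/eqP/zw|].
Qed.
End Blocks.

(** * Cycles and cliques of Gamma(a,b) *)

Section GammaCliques.
Variables (V : choiceType) (E : rel V) (a b : nat).
Hypothesis hG : is_Gamma a b E.

Lemma Gamma_cycle_adj c u v : cycle E c -> uniq c ->
  u \in c -> v \in c -> u != v -> E u v.
Proof.
move=> cyc uc uc' vc uv; have [[sE _] _ _ hB _] := hG.
have sc : (2 <= size c)%N.
  rewrite -[2%N]/(size [:: u; v]); apply: uniq_leq_size; rewrite /= ?inE ?uv //.
  by move=> w; rewrite !inE => /orP[] /eqP ->.
have [H bH cH] := cycle_sub_block sE cyc uc sc.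
have [sH _ _] := bH.
by have [] := sH.2 u v ((hB H bH).2 u v (cH u uc') (cH v vc) (elimN eqP uv)).
Qed.

Lemma Gamma_cycle_size c : (2 <= b)%N -> cycle E c -> uniq c -> (size c <= b)%N.
Proof.
move=> b2 cyc uc; have [[sE _] _ _ hB _] := hG.
have [sc|sc] := leqP 2 (size c); last by apply: leq_trans b2; apply: ltnW.
have [H bH cH] := cycle_sub_block sE cyc uc sc.
have [s [us <- ms]] := card_II_seq (hB H bH).1.
by apply: uniq_leq_size => // v vc; apply/ms/cH.
Qed.

(** Two or more pairwise adjacent vertices, listed in any order, form a cycle, so the bound for
    cycles applies. *)
Lemma Gamma_clique_size c : (2 <= b)%N -> uniq c ->
  {in c &, forall u v, u != v -> E u v} -> (size c <= b)%N.
Proof.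
move=> b2; case: c => [|u [|v c]] // uc hc; first exact: ltnW.
apply: Gamma_cycle_size => //.
have : pairwise E (u :: v :: c).
  elim: {u v c}(u :: v :: c) uc hc => //= w s IH /andP[ws us] hc.
  apply/andP; split.
    apply/allP => t ts; apply: hc; rewrite ?inE ?eqxx ?ts ?orbT //.
    by apply: contraNneq ws => ->.
  by apply: IH => // y z ys zs; apply: hc; rewrite inE ?ys ?zs orbT.
move=> /pairwise_sorted /= /andP[uv vc]; rewrite /= uv rcons_path vc /=.
apply: hc; first by rewrite inE mem_last orbT.
  exact: mem_head.
by apply: contraTneq uc => <-; rewrite /= mem_last.
Qed.

(** An infinite vertex set is nonempty, and as [a] is positive some block passes through a chosen
    vertex; its vertices form the clique. *)
Lemma Gamma_clique_exists : (0 < a)%N ->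
  exists s : seq V, [/\ uniq s, size s = b & {in s &, forall u v, u != v -> E u v}].
Proof.
move=> a0; have [_ iV _ hB hD] := hG.
have [v _] : exists v : V, [set: V]%classic v.
  by apply/set0P/negP => /eqP e0; apply: iV; rewrite e0.
have [H [bH _]] : exists H, is_block E H /\ sverts H v.
  case: a a0 hD => // n _ /(_ v) /eq_cardSP[H ? _]; by exists H.
have [s [us ss ms]] := card_II_seq (hB H bH).1; exists s; split=> //.
move=> u w /ms Hu /ms Hw /eqP uw; have [sH _ _] := bH.
by have [] := sH.2 u w ((hB H bH).2 u w Hu Hw uw).
Qed.
End GammaCliques.

(** * Graph distance, geodesics and walks avoiding a vertex *)

Section Distance.
Variables (V : choiceType) (E : rel V).
Hypotheses (symE : symmetric E) (connE : forall u v, linked E u v).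

Local Notation d := (gdist E).

(** Connectedness rules out the default value in [gdist], which is therefore a true minimum. *)
Lemma gdist_spec u v : walk E u v (d u v) /\ forall n, walk E u v n -> (d u v <= n)%N.
Proof.
rewrite /gdist; case: pselect => [h|[]]; last first.
  by have [n h] := connE u v; exists n; apply/asboolP.
case: ex_minnP => m /asboolP wm hm; split=> // n wn; exact/hm/asboolP.
Qed.

Lemma gdist_sym u v : d u v = d v u.
Proof.
apply/eqP; rewrite eqn_leq; apply/andP.
by split; apply: (gdist_spec _ _).2; apply: walk_sym => //; apply: (gdist_spec _ _).1.
Qed.

Lemma gdist_triangle v u w : (d u w <= d u v + d v w)%N.
Proof.
apply: (gdist_spec _ _).2; apply: walk_cat (gdist_spec v w).1.
exact: (gdist_spec _ _).1.
Qed.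

Lemma gdist_adj u v : E u v -> (d u v <= 1)%N.
Proof. by move=> uv; apply: (gdist_spec _ _).2; apply: walk_edge. Qed.

Lemma gdistxx u : d u u = 0%N.
Proof. by apply/eqP; rewrite -leqn0; apply: (gdist_spec _ _).2; exists [::]. Qed.

Lemma gdist_eq0 u v : d u v = 0%N -> u = v.
Proof.
move=> duv; have [+ _] := gdist_spec u v; rewrite duv.
by move=> [p [_ + /size0nil p0]]; rewrite p0.
Qed.

Lemma gdist_adjE u v : E u v -> u != v -> d u v = 1%N.
Proof.
move=> uv nuv; have := gdist_adj uv; rewrite leq_eqVlt ltnS leqn0.
by case/orP => [/eqP//|/eqP/gdist_eq0 e]; rewrite e eqxx in nuv.
Qed.

Lemma gdist_adjl u v w : E u v -> (d u w <= (d v w).+1)%N.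
Proof.
by move=> uv; have := gdist_triangle v u w; have := gdist_adj uv; lia.
Qed.

Lemma gdist_step u v : u != v -> exists2 w, E u w & d u v = (d w v).+1.
Proof.
move=> uv; have [+ _] := gdist_spec u v.
move=> [[|w p] [/= ep lp sp]]; first by rewrite lp eqxx in uv.
have /andP[uw wp] := ep; exists w => //; apply/eqP; rewrite eqn_leq gdist_adjl //=.
by rewrite -sp ltnS; apply: (gdist_spec _ _).2; exists p.
Qed.

(** Being joined after the deletion of [w]; the endpoints must differ from [w] too. *)
Definition avoid w u v :=
  exists p, [/\ path E u p, last u p = v & w \notin u :: p].

Lemma avoid_refl w u : u != w -> avoid w u u.
Proof. by move=> uw; exists [::]; rewrite inE eq_sym. Qed.

Lemma avoid_trans w v u t : avoid w u v -> avoid w v t -> avoid w u t.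
Proof.
move=> [p [ep lp wp]] [q [eq lq wq]]; exists (p ++ q); split.
- by rewrite cat_path ep lp.
- by rewrite last_cat lp.
- rewrite -cat_cons mem_cat negb_or wp /=.
  by move: wq; rewrite inE negb_or => /andP[].
Qed.

Lemma avoid_edge w u v : E u v -> u != w -> v != w -> avoid w u v.
Proof.
by move=> uv uw vw; exists [:: v]; rewrite /= uv !inE !(eq_sym w) (negPf uw) (negPf vw).
Qed.

Lemma avoid_sym w u v : avoid w u v -> avoid w v u.
Proof.
move=> [p [ep lp wp]]; exists (rev (belast u p)); split.
- have := rev_path E u p; rewrite lp => ->.
  by rewrite (eq_path (e' := E)) // => x y; rewrite symE.
- by case: p lp {ep wp} => [|x p] //= _; rewrite rev_cons last_rcons.
- apply: contra wp; rewrite inE mem_rev -lp => /orP[/eqP->|]; first exact: mem_last.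
  exact: mem_belast.
Qed.

(** Along a geodesic from [v] the distance to [r] strictly decreases, so after [v] it meets only
    vertices closer to [r] than [w] is. *)
Lemma avoid_geodesic r w v : v != w -> (d v r <= d w r)%N -> avoid w v r.
Proof.
move: {2}(d v r) (erefl (d v r)) => n; elim: n v => [|n IH] v dv vw le_vw.
  by rewrite (gdist_eq0 dv) in vw *; apply: avoid_refl.
have [|q vq dq] := @gdist_step v r.
  by apply: contra_eq_neq dv => ->; rewrite gdistxx.
have qw : q != w by apply: contraTneq le_vw => <-; rewrite dq ltnn.
apply: avoid_trans (avoid_edge vq vw qw) _; apply: IH => //; lia.
Qed.

End Distance.

(** * Rooted graphs in which every cycle spans a clique *)

Section BlockGraph.
Variables (V : choiceType) (E : rel V).
Hypotheses (symE : symmetric E) (irrE : irreflexive E).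
Hypothesis connE : forall u v, linked E u v.
Hypothesis cliqueE : forall c u v, cycle E c -> uniq c ->
  u \in c -> v \in c -> u != v -> E u v.

Local Notation d := (gdist E).

Lemma adj_neq u v : E u v -> u != v.
Proof. by move=> uv; apply: contraTneq uv => ->; rewrite irrE. Qed.

(** Shortened to a simple path, the walk from [u] to [v] closes up through [w] to a cycle, which
    spans a clique. *)
Lemma avoid_adj w u v : E w u -> E w v -> u != v -> avoid E w u v -> E u v.
Proof.
move=> wu wv uv [p [ep lp wp]]; move: lp wp; case: (shortenP ep) => q eq uq sq lq wp.
have wq : w \notin u :: q.
  apply: contra wp; rewrite !inE => /orP[->//|/sq ->]; exact: orbT.
apply: (@cliqueE (w :: u :: q)) => //.
- by rewrite /= wu rcons_path eq lq symE.
- by rewrite /= wq.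
- by rewrite !inE eqxx orbT.
- by rewrite inE -lq mem_last orbT.
Qed.

Variable o : V.

Local Notation depth u := (d u o).

(** Let [t] be the next vertex from [p] towards the root. If [p] and [q] differ, the walk from [v]
    through [q] and the root to [t] avoids [p], so [v] and [t] are adjacent, although their depths
    differ by 2. *)
Lemma parent_unique v p q : E v p -> E v q ->
  depth v = (depth p).+1 -> depth v = (depth q).+1 -> p = q.
Proof.
move=> vp vq dp dq; apply/eqP; apply: contraT => pq.
have po : p != o.
  apply: contraNneq pq => po; apply/eqP; rewrite po; apply/esym.
  by apply: (gdist_eq0 connE (v := o)); move: dp dq; rewrite po gdistxx //; lia.
have [t pt dt] := gdist_step connE po.
have vt : v != t by apply: contra_eq_neq dt => <-; lia.
have tp : t != p by rewrite eq_sym; apply: adj_neq.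
have pv : v != p by apply: adj_neq.
have := avoid_adj (w := p) (u := v) (v := t); rewrite symE => /(_ vp pt vt).
have avt : avoid E p v t.
  apply: (avoid_trans (v := q)); first by apply: avoid_edge => //; rewrite eq_sym.
  apply: (avoid_trans (v := o)); first by apply: avoid_geodesic => //; rewrite 1?eq_sym //; lia.
  by apply: avoid_sym => //; apply: avoid_geodesic => //; lia.
move=> /(_ avt) /(gdist_adjl connE o); lia.
Qed.

(** The default [u] is taken only at the root. *)
Definition parent u := xget u (fun p => E u p /\ depth u = (depth p).+1).

Lemma parentP u : u != o -> E u (parent u) /\ depth u = (depth (parent u)).+1.
Proof.
move=> uo; have [p up dp] := gdist_step connE uo.
by apply: (@xgetPex V u (fun p => E u p /\ depth u = (depth p).+1)); exists p.
Qed.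

Lemma adj_lower u w : u != o -> E u w -> w != parent u -> (depth u <= depth w)%N.
Proof.
move=> uo uw wp; have [up dp] := parentP uo.
have := gdist_adjl connE o uw; rewrite leq_eqVlt => /orP[/eqP dw|]; last by rewrite ltnS.
by move: wp; rewrite (parent_unique uw up dw dp) eqxx.
Qed.

(** Suppose that a geodesic from [u] to [v] starts with some [w] other than the parent. Then [w] is
    at least as deep as [u] and differs from [v], so the geodesic continues to some [w2]. The walk
    from [u] through its parent, the root and [v] to [w2] avoids [w]; hence [u] and [w2] are
    adjacent, a shortcut. *)
Lemma gdist_parent u v : u != o -> u != v -> (depth v <= depth u)%N ->
  ~~ (E u v && (depth u == depth v)) -> d u v = (d (parent u) v).+1.
Proof.
move=> uo uv dvu nsib; have [up dp] := parentP uo.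
set p := parent u in up dp *.
have pu : p != u by rewrite eq_sym; apply: adj_neq.
have [w uw dw] := gdist_step connE uv.
have [ewp|wp] := eqVneq w p; first by rewrite -ewp.
have wu : w != u by rewrite eq_sym; apply: adj_neq.
have dwu : (depth u <= depth w)%N by apply: adj_lower.
have wv : w != v.
  by apply: contraNneq nsib => ewv; rewrite -ewv in dvu *; rewrite uw eqn_leq dwu.
have [w2 ww2 dw2] := gdist_step connE wv.
have w2w : w2 != w by rewrite eq_sym; apply: adj_neq.
have uw2 : u != w2 by apply: contra_eq_neq dw => ->; lia.
have : E u w2.
  apply: (avoid_adj (w := w)) => //; first by rewrite symE.
  apply: (avoid_trans (v := p)); first by apply: avoid_edge => //; rewrite eq_sym.
  apply: (avoid_trans (v := o)).
    by apply: avoid_geodesic => //; rewrite 1?eq_sym //; lia.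
  apply: (avoid_trans (v := v)); apply: avoid_sym => //; apply: avoid_geodesic => //.
  - by rewrite eq_sym.
  - lia.
  - lia.
move=> /(gdist_adjl connE v); lia.
Qed.

(** Equality is included to make this an equivalence relation. Vertices with the same parent need
    not be siblings, since they may lie in different blocks. *)
Definition sibling u v := (u == v) || E u v && (depth u == depth v).

(** If the parents differ, [v] and [parent u] are neighbours of [u] joined through the root without
    meeting [u]. So they are adjacent, and [v] has two parents. *)
Lemma sibling_parent u v : u != o -> sibling u v -> parent u = parent v.
Proof.
move=> uo /orP[/eqP->//|/andP[uv /eqP duv]].
have vo : v != o.
  apply: contraNneq uo => vo; apply/eqP/(gdist_eq0 connE).
  by rewrite duv vo gdistxx.
have [up dp] := parentP uo; have [vq dq] := parentP vo.
have nuv := adj_neq uv.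
apply/eqP; apply: contraT => pq.
have vp : v != parent u by apply: contra_eq_neq dp => <-; lia.
have uq : u != parent v by apply: contra_eq_neq dq => <-; lia.
have : E v (parent u).
  apply: (avoid_adj (w := u)) => //.
  apply: (avoid_trans (v := o)).
    by apply: avoid_geodesic => //; rewrite 1?eq_sym //; lia.
  apply: avoid_sym => //; apply: avoid_geodesic => //; last lia.
  by rewrite eq_sym; apply: adj_neq.
move=> /parent_unique /(_ vq); rewrite -dq -duv => /(_ dp erefl) e.
by rewrite e eqxx in pq.
Qed.

Lemma sibling_sym : symmetric sibling.
Proof.
by move=> u v; rewrite /sibling eq_sym symE; congr (_ || _ && _); rewrite eq_sym.
Qed.

Lemma sibling_root v : sibling o v = (o == v).
Proof.
rewrite /sibling; case: eqVneq => //= ov; apply/negbTE/negP => /andP[_].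
by rewrite gdistxx // eq_sym => /eqP /(gdist_eq0 connE) vo; rewrite vo eqxx in ov.
Qed.

(** Both ends are neighbours of the common parent, which the walk through the middle vertex
    avoids. *)
Lemma sibling_trans : transitive sibling.
Proof.
move=> v u w; have [->|uo] := eqVneq u o.
  by rewrite sibling_root => /eqP <-.
move=> uv; have pv := sibling_parent uo uv.
have [<-//|nuv] := eqVneq u v; have [<-//|nvw] := eqVneq v w.
move: uv; rewrite /sibling (negPf nuv) (negPf nvw) /= => /andP[uv /eqP duv].
move=> /andP[vw /eqP dvw]; have [//|nuw] := eqVneq u w.
rewrite duv dvw eqxx andbT /=.
have [up dp] := parentP uo.
have vo : v != o.
  apply: contra_eq_neq dp => vo; rewrite duv vo gdistxx //.
have pw : parent v = parent w by apply: sibling_parent => //; rewrite /sibling vw dvw eqxx orbT.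
have wo : w != o.
  apply: contra_eq_neq dp => wo; rewrite duv dvw wo gdistxx //.
have [wp _] := parentP wo; have [vp _] := parentP vo.
apply: (avoid_adj (w := parent u)) => //.
- by rewrite symE.
- by rewrite pv pw symE.
- apply: (avoid_trans (v := v)); apply: avoid_edge => //.
  + exact: adj_neq.
  + by rewrite pv; apply: adj_neq.
  + by rewrite pv; apply: adj_neq.
  + by rewrite pv pw; apply: adj_neq.
Qed.

Lemma gdist_sibling u v : sibling u v -> u != v -> d u v = 1%N.
Proof. by move=> /orP[->//|/andP[uv _]] nuv; apply: gdist_adjE. Qed.

Lemma gdist_parent_lt u v : (depth v < depth u)%N -> d u v = (d (parent u) v).+1.
Proof.
move=> lt_vu; apply: gdist_parent.
- by apply: contraTneq lt_vu => ->; rewrite gdistxx.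
- by apply: contraTneq lt_vu => ->; rewrite ltnn.
- exact: ltnW.
- by rewrite negb_and (gtn_eqF lt_vu) orbT.
Qed.

(** One parent step from [u] leaves [v] strictly deeper, so a second parent step can be taken from
    [v]. *)
Lemma gdist_parents u v : depth u = depth v -> ~~ sibling u v ->
  d u v = (d (parent u) (parent v)).+2.
Proof.
move=> duv; rewrite negb_or => /andP[uv nsib].
have uo : u != o.
  apply: contraNneq uv => uo; rewrite uo in duv *; apply/eqP/esym/(gdist_eq0 connE).
  by rewrite -duv gdistxx.
have [_ dp] := parentP uo.
have e : d v (parent u) = (d (parent v) (parent u)).+1.
  by apply: gdist_parent_lt; rewrite -duv dp.
rewrite (gdist_parent uo uv _ nsib) ?duv //.
by rewrite (gdist_sym symE connE (parent u) v) e (gdist_sym symE connE (parent u)).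
Qed.

(** A sibling class together with its common parent is a clique, hence the bound [b - 1]; the root
    is alone in its class. *)
Lemma sibling_count b (s : seq V) u : (2 <= b)%N ->
  (forall c, uniq c -> {in c &, forall v w, v != w -> E v w} -> (size c <= b)%N) ->
  uniq s -> (count (sibling u) s <= b.-1)%N.
Proof.
move=> b2 hb us; have [->|uo] := eqVneq u o.
  apply: (@leq_trans 1); last by case: b b2 {hb} => [|[]].
  by rewrite (eq_count (a2 := pred1 o)) ?count_uniq_mem ?leq_b1 // => v;
    rewrite sibling_root eq_sym.
pose c := [seq v <- s | sibling u v].
rewrite -size_filter -ltnS (ltn_predK b2).
have sibp v : sibling u v -> E v (parent u).
  move=> uv; rewrite (sibling_parent uo uv); apply: (parentP _).1.
  by apply: contraNneq uo => vo; move: uv; rewrite vo sibling_sym sibling_root eq_sym.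
rewrite -[X in (X <= _)%N]/(size (parent u :: c)); apply: hb => [|v w].
  rewrite /= filter_uniq // mem_filter andbT; apply/negP => /andP[/sibp].
  by rewrite irrE.
rewrite !inE !mem_filter => /orP[/eqP->|/andP[uv _]] /orP[/eqP->|/andP[uw _]].
- by rewrite eqxx.
- by rewrite symE => _; apply: sibp.
- by move=> _; apply: sibp.
- move=> vw; have := sibling_trans; move=> /(_ u v w).
  by rewrite sibling_sym => /(_ uv uw); rewrite /sibling (negPf vw) => /andP[].
Qed.

End BlockGraph.

(** * Positive semidefinite kernels *)

Section Kernels.
Variable R : realType.
Local Notation C := R[i].

Lemma psd_kernel_ext (V : Type) (Q Q' : V -> V -> C) :
  (forall u v, Q u v = Q' u v) -> psd_kernel Q -> psd_kernel Q'.
Proof.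
move=> QQ' hQ n u c; have := hQ n u c.
by under eq_bigr do under eq_bigr do rewrite QQ'.
Qed.

Lemma psd_kernelD (V : Type) (Q Q' : V -> V -> C) :
  psd_kernel Q -> psd_kernel Q' -> psd_kernel (fun u v => Q u v + Q' u v).
Proof.
move=> hQ hQ' n u c; have := addr_ge0 (hQ n u c) (hQ' n u c).
rewrite -big_split /=; congr (0 <= _); apply: eq_bigr => i _.
by rewrite -big_split /=; apply: eq_bigr => j _; rewrite mulrDr.
Qed.

(** Each point [u] is replaced by [s u] times the point [h u], and the factors are absorbed into the
    coefficients. *)
Lemma psd_kernel_comp (V W : Type) (Q : W -> W -> C) (h : V -> W) (s : V -> C) :
  psd_kernel Q -> psd_kernel (fun u v => s u * (s v)^* * Q (h u) (h v)).
Proof.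
move=> hQ n u c; have := hQ n (h \o u) (fun i => c i * s (u i)).
congr (0 <= _); apply: eq_bigr => i _; apply: eq_bigr => j _ /=.
by rewrite rmorphM; ring.
Qed.

Lemma psd_kernelZ (V : Type) (Q : V -> V -> C) (k : C) :
  0 <= k -> psd_kernel Q -> psd_kernel (fun u v => k * Q u v).
Proof.
move=> k0 hQ n u c; have := mulr_ge0 k0 (hQ n u c).
rewrite mulr_sumr; congr (0 <= _); apply: eq_bigr => i _.
by rewrite mulr_sumr; apply: eq_bigr => j _; ring.
Qed.

Lemma psd_kernel1 (V : Type) : psd_kernel (fun u v : V => 1 : C).
Proof.
move=> n u c; have := exprn_ge0 2 (normr_ge0 (\sum_i c i)).
rewrite normCK rmorph_sum mulr_suml; congr (0 <= _); apply: eq_bigr => i _.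
by rewrite mulr_sumr; apply: eq_bigr => j _; rewrite mulr1.
Qed.

(** Repeated points can be merged by adding up their coefficients. *)
Lemma psd_kernel_uniq (V : eqType) (Q : V -> V -> C) :
  (forall (s : seq V) (c : V -> C), uniq s ->
    0 <= \sum_(u <- s) \sum_(v <- s) c u * (c v)^* * Q u v) -> psd_kernel Q.
Proof.
move=> hQ n u c; pose s := undup (codom u).
pose S v := \sum_(i | u i == v) c i.
have pick (F : 'I_n -> V -> C) :
    \sum_i F i (u i) = \sum_(v <- s) \sum_(i | u i == v) F i v.
  rewrite (exchange_big_dep xpredT) //=; apply: eq_bigr => i _.
  rewrite -big_filter (_ : [seq _ <- _ | _] = [:: u i]) ?big_seq1 //.
  rewrite (eq_filter (a2 := pred1 (u i))) => [|v]; last by rewrite /= eq_sym.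
  by rewrite filter_pred1_uniq ?undup_uniq // mem_undup codom_f.
have := hQ s S (undup_uniq _); congr (0 <= _).
rewrite (pick (fun i v => \sum_j c i * (c j)^* * Q v (u j))).
apply: eq_bigr => v _.
under [RHS]eq_bigr do rewrite (pick (fun j w => _ * (c j)^* * Q v w)).
rewrite exchange_big /=; apply: eq_bigr => w _.
rewrite /S rmorph_sum -mulrA mulr_suml; apply: eq_bigr => i _.
rewrite mulrA !mulr_sumr mulr_suml; apply: eq_bigr => j _; ring.
Qed.

Lemma psd_kernel_eq (V W : eqType) (f : V -> W) :
  psd_kernel (fun u v => (f u == f v)%:R : C).
Proof.
apply: (psd_kernel_ext (Q := fun u v => 1 * 1^* * (f u == f v)%:R)).
  by move=> u v; rewrite rmorph1 !mul1r.
apply: (@psd_kernel_comp _ _ (fun u v => (u == v)%:R) f (fun=> 1)).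
apply: psd_kernel_uniq => s c us; rewrite big_seq_cond; apply: sumr_ge0 => u.
rewrite andbT => us'; rewrite (bigD1_seq u) //= big1 => [|v vu].
  by rewrite eqxx mulr1 addr0 -normCK exprn_ge0.
by rewrite eq_sym (negPf vu) mulr0.
Qed.

(* The form equals half the sum of [r u v * |c u - c v|^2] plus a nonnegative
   diagonal part. *)
Lemma psd_kernel_diag_dominant (V : eqType) (r : rel V) (m : nat) :
  symmetric r ->
  (forall s u, uniq s -> (count (r u) s <= m)%N) ->
  psd_kernel (fun u v => m%:R * (u == v)%:R - (r u v)%:R : C).
Proof.
move=> rs hr; apply: psd_kernel_uniq => s c us.
set A := \sum_(u <- s) _.
have h : 0 <= \sum_(u <- s) \sum_(v <- s) (r u v)%:R * `|c u - c v| ^+ 2.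
  by do 2!apply: sumr_ge0 => ? _; rewrite mulr_ge0 ?exprn_ge0.
have k : 0 <= \sum_(u <- s) (m - count (r u) s)%:R * `|c u| ^+ 2 *+ 2.
  by apply: sumr_ge0 => ? _; rewrite mulrn_wge0 // mulr_ge0 ?exprn_ge0.
suff e : A *+ 2 = \sum_(u <- s) \sum_(v <- s) (r u v)%:R * `|c u - c v| ^+ 2
    + \sum_(u <- s) (m - count (r u) s)%:R * `|c u| ^+ 2 *+ 2.
  by rewrite -(pmulrn_lge0 _ (isT : (0 < 2)%N)) e addr_ge0.
(* In terms of these sums [A = m * P - X], while the two nonnegative parts are [2 * D - 2 * X] and
   [2 * m * P - 2 * D]. *)
pose P := \sum_(u <- s) `|c u| ^+ 2.
pose D := \sum_(u <- s) (count (r u) s)%:R * `|c u| ^+ 2.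
pose X := \sum_(u <- s) \sum_(v <- s) (r u v)%:R * (c u * (c v)^*).
have eA : A = m%:R * P - X.
  rewrite /A /P /X mulr_sumr -sumrB big_seq [RHS]big_seq; apply: eq_bigr => u us'.
  transitivity (\sum_(v <- s) (m%:R * (c u * (c v)^*) * (u == v)%:R
     - (r u v)%:R * (c u * (c v)^*))).
    by apply: eq_bigr => v _; ring.
  rewrite sumrB; congr (_ - _); rewrite (bigD1_seq u) //= big1 => [|v vu].
    by rewrite eqxx addr0 mulr1 normCK.
  by rewrite eq_sym (negPf vu) mulr0.
have eD u : \sum_(v <- s) (r u v)%:R = (count (r u) s)%:R :> C.
  by rewrite -sum1_count natr_sum [RHS]big_mkcond; apply: eq_bigr => v _; case: (r u v).
have e1 : \sum_(u <- s) \sum_(v <- s) (r u v)%:R * `|c u - c v| ^+ 2 = D *+ 2 - X *+ 2.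
  transitivity (\sum_(u <- s) \sum_(v <- s) ((r u v)%:R * `|c u| ^+ 2
     + (r u v)%:R * `|c v| ^+ 2 - (r u v)%:R * (c u * (c v)^*)
     - (r u v)%:R * (c v * (c u)^*))).
    apply: eq_bigr => u _; apply: eq_bigr => v _.
    by rewrite !normCK rmorphB; ring.
  under eq_bigr do rewrite !sumrB big_split /=.
  rewrite !sumrB big_split /= -/X.
  have -> : \sum_(u <- s) \sum_(v <- s) (r u v)%:R * `|c u| ^+ 2 = D.
    by apply: eq_bigr => u _; rewrite -mulr_suml eD.
  have -> : \sum_(u <- s) \sum_(v <- s) (r u v)%:R * `|c v| ^+ 2 = D.
    rewrite exchange_big; apply: eq_bigr => u _; rewrite -mulr_suml -eD.
    by congr (_ * _); apply: eq_bigr => v _; rewrite rs.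
  have -> : \sum_(u <- s) \sum_(v <- s) (r u v)%:R * (c v * (c u)^*) = X.
    by rewrite exchange_big; do 2!apply: eq_bigr => ? _; rewrite rs.
  ring.
have e2 : \sum_(u <- s) (m - count (r u) s)%:R * `|c u| ^+ 2 *+ 2
    = m%:R * P *+ 2 - D *+ 2.
  rewrite sumrMnl -mulrnBl; congr (_ *+ 2); rewrite /P /D mulr_sumr -sumrB.
  by apply: eq_bigr => u _; rewrite natrB ?hr // mulrBl.
by rewrite e1 e2 eA; ring.
Qed.

(** For [x >= 0] the relation is equality of classes, a class being encoded by its indicator
    function. For [x <= 0] the kernel is [1 + m * x] times the identity plus [- x] times the
    diagonally dominant kernel [m - r]. *)
Lemma psd_kernel_equiv (V : choiceType) (r : rel V) (m : nat) (x : R) :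
  reflexive r -> symmetric r -> transitive r ->
  (forall s u, uniq s -> (count (r u) s <= m)%N) ->
  0 <= 1 + m%:R * x ->
  psd_kernel (fun u v => (u == v)%:R + x%:C * (r u v)%:R : C).
Proof.
move=> rr rs rt hr hx; have [x0|/ltW x0] := leP 0 x.
  apply: psd_kernelD; first exact: (@psd_kernel_eq _ _ id).
  apply: psd_kernelZ; first by rewrite ler0c.
  apply: psd_kernel_ext (@psd_kernel_eq V {classic V -> bool} (fun u : V => r u)).
  move=> u v; congr (_%:R); congr nat_of_bool; apply/eqP/idP => [e|uv].
    by have := congr1 (@^~ v) e; rewrite rr.
  apply/funext => w; apply/idP/idP; apply: rt => //; by rewrite rs.
pose h := psd_kernelD (psd_kernelZ _ (@psd_kernel_eq V V id))
  (psd_kernelZ _ (psd_kernel_diag_dominant rs hr)).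
apply: psd_kernel_ext (h (1 + m%:R * x)%:C (- x)%:C _ _); rewrite ?ler0c ?oppr_ge0 //.
move=> u v /=; rewrite !(rmorphD, rmorphM, rmorphN, rmorph1, rmorph_nat); ring.
Qed.

End Kernels.

(** * The kernel of powers of [x] on Gamma(a,b) *)

Section GammaKernel.
Variables (R : realType) (V : choiceType) (E : rel V) (a b : nat).
Hypotheses (b_ge2 : (2 <= b)%N) (hG : is_Gamma a b E).
Local Notation C := R[i].
Local Notation d := (gdist E).

Let symE : symmetric E. Proof. by have [[]] := hG. Qed.
Let irrE : irreflexive E. Proof. by have [[]] := hG. Qed.
Let connE u v : linked E u v.
Proof. by have [_ _ cE _ _] := hG; apply: cE. Qed.

Lemma Gamma_psd_bounds (x : R) : (0 < a)%N ->
  psd_kernel (fun u v : V => (x ^+ d u v)%:C) ->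
  0 <= 1 + (b.-1)%:R * x /\ x <= 1.
Proof.
move=> a0 hQ; have [s [us ss es]] := Gamma_clique_exists hG a0.
have [u0 _] : exists u0, u0 \in s.
  case: (s) ss => [e|u t _]; last by exists u; rewrite mem_head.
  by move: b_ge2; rewrite -e.
have inj (i j : 'I_b) : i != j -> nth u0 s i != nth u0 s j.
  by rewrite nth_uniq ?ss.
have Qs (i j : 'I_b) : x ^+ d (nth u0 s i) (nth u0 s j) = if i == j then 1 else x.
  case: eqVneq => [->|ij]; first by rewrite gdistxx.
  by rewrite gdist_adjE ?inj // es ?mem_nth ?ss ?inj.
split.
  (* With all coefficients 1 on a clique of size [b], each of the [b] rows sums to
     [1 + (b - 1) * x]. *)
  have := hQ b (fun i => nth u0 s i) (fun=> 1).
  rewrite (_ : \sum_i _ = (b%:R * (1 + (b.-1)%:R * x))%:C).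
    by rewrite ler0c pmulr_rge0 // ltr0n; apply: leq_trans b_ge2.
  transitivity (\sum_(i < b) (1 + (b.-1)%:R * x)%:C); last first.
    by rewrite sumr_const card_ord [RHS]rmorphM rmorph_nat [RHS]mulr_natl.
  apply: eq_bigr => i _; rewrite (bigD1 i) //= rmorph1 !mul1r Qs eqxx.
  rewrite rmorphD; congr (_ + _).
  transitivity (\sum_(j < b | j != i) x%:C).
    by apply: eq_bigr => j ji; rewrite !mul1r Qs eq_sym (negPf ji).
  by rewrite sumr_const cardC1 card_ord [RHS]rmorphM rmorph_nat [RHS]mulr_natl.
have b1 : (1 < b)%N by [].
pose i0 := Ordinal (ltnW b1); pose i1 := Ordinal b1.
(* Coefficients 1 and -1 on two adjacent vertices give the value [2 - 2 * x]. *)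
have := hQ 2 (fun i => nth u0 s i) (fun i => if val i == 0%N then 1 else -1).
rewrite !big_ord_recl !big_ord0 /= !addr0.
have := Qs i0 i0; have := Qs i0 i1; have := Qs i1 i0; have := Qs i1 i1 => /=.
move=> -> -> -> ->; rewrite rmorphN !rmorph1 => h.
suff : 0 <= (2 - x *+ 2)%:C by rewrite ler0c; lra.
by move: h; congr (0 <= _); rewrite rmorphB !rmorphMn rmorph1; ring.
Qed.

Lemma Gamma_psd (x : R) : 0 <= 1 + (b.-1)%:R * x -> x <= 1 ->
  psd_kernel (fun u v : V => (x ^+ d u v)%:C).
Proof.
move=> hx x1 n u c.
case: n u c => [|n] u c; first by rewrite big_ord0.
(* The first of the given points serves as root. *)
pose o := u ord0.
pose dep v := d v o.
have cyc := Gamma_cycle_adj hG.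
pose par := parent E o.
pose r := sibling E o.
(* Extending by 0 below depth [N] keeps all these kernels on [V], ready for induction on [N]. *)
pose Q N := fun v w => ((dep v <= N)%N && (dep w <= N)%N)%:R * (x ^+ d v w)%:C : C.
have conjr (y : R) : ((y%:C)^* )%R = y%:C by exact: conjc_real.
have conjb (y : bool) : ((y%:R : C)^* )%R = y%:R by rewrite rmorph_nat.
pose z : C := x%:C.
have zX m : (x ^+ m)%:C = z ^+ m by rewrite rmorphXn.
(* These identities settle equal vertices and distinct siblings of the top level: their parents
   coincide, so the substituted form contributes [y * y]. *)
have schur_diag (T : comPzRingType) (y : T) : y * y + (1 - y) * (1 + y) = 1 by ring.
have schur_offdiag (T : comPzRingType) (y : T) : y * y + (1 - y) * y = y by ring.
have psdQ N : psd_kernel (Q N).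
  elim: N => [|N IH].
    (* Only the root has depth 0, so [Q 0] is the rank-one kernel of its indicator. *)
    apply: psd_kernel_ext
      (psd_kernel_comp id (fun v => (v == o)%:R) (@psd_kernel1 R V)).
    move=> v w /=; rewrite /Q /dep !leqn0 mulr1 conjb.
    have e0 t : (d t o == 0%N) = (t == o).
      by apply/eqP/eqP => [/(gdist_eq0 connE)|->] //; rewrite gdistxx.
    rewrite !e0 -natrM mulnb; case: andP => [[/eqP-> /eqP->]|]; last by rewrite mul0r.
    by rewrite gdistxx ?mulr1.
  (* [h] and [s] encode the substitution: a vertex of depth [N + 1] becomes [x] times its parent,
     every other vertex stays. *)
  pose L v := dep v == N.+1.
  pose h v := if L v then par v else v.
  pose s v := if L v then x%:C else 1 : C.
  have psdr : psd_kernel (fun v w => (v == w)%:R + x%:C * (r v w)%:R : C).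
    apply: (psd_kernel_equiv (m := b.-1)) => //.
    - by move=> v; rewrite /r /sibling eqxx.
    - exact: sibling_sym.
    - exact: sibling_trans.
    - move=> t v ut; apply: sibling_count => // k uk ck.
      exact: (Gamma_clique_size hG).
  have hx1 : 0 <= (1 - x)%:C :> C by rewrite ler0c subr_ge0.
  apply: psd_kernel_ext (psd_kernelD (psd_kernel_comp h s IH)
    (psd_kernelZ hx1 (psd_kernel_comp id (fun v => (L v)%:R) psdr))).
  move=> v w /=; rewrite /Q conjb.
  have Lo t : L t -> t != o.
    by apply: contraTneq => ->; rewrite /L /dep gdistxx.
  have dpar t : L t -> dep (par t) = N.
    move=> Lt; have [_ e] := parentP connE (Lo t Lt).
    by move: Lt; rewrite /L /dep e => /eqP[].
  have hL t : (dep (h t) <= N)%N = (dep t <= N.+1)%N.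
    rewrite /h; case: ifP => [Lt|]; first by rewrite dpar // (eqP Lt) !leqnn.
    by rewrite /L => Lt; rewrite [RHS]leq_eqVlt Lt ltnS.
  rewrite !hL.
  have [/andP[dv dw]|] := boolP (_ && _); last first.
    move=> ndvw; rewrite !mul0r mulr0 add0r.
    have [/eqP Lv|_] := boolP (L v); last by rewrite !(mul0r, mulr0).
    have [/eqP Lw|_] := boolP (L w); last by rewrite !(mul0r, mulr0).
    by move: ndvw; rewrite Lv Lw leqnn.
  rewrite !mul1r /s /h !zX (_ : (1 - x)%:C = 1 - z); last first.
    by rewrite rmorphB rmorph1.
  have low t : (dep t <= N.+1)%N -> ~~ L t -> (dep t < N.+1)%N.
    by move=> dt Lt; rewrite ltn_neqAle Lt.
  (* Two non-siblings of the top level take two parent steps, a factor [x] each; a single top-level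
     vertex takes one; with none, nothing changes. *)
  have [Lv|Lv] := ifPn; have [Lw|Lw] := ifPn.
  - rewrite !mul1r conjr -/z.
    have [<-|vw] := eqVneq v w.
      rewrite !gdistxx // /r /sibling eqxx orTb mulr1n !expr0 !mulr1.
      exact: schur_diag.
    have [rvw|rvw] := boolP (r v w).
      rewrite (gdist_sibling connE rvw vw).
      have -> : par v = par w by apply: (sibling_parent (E := E)) => //; apply: Lo.
      rewrite gdistxx // expr0 expr1 mulr0n mulr1n add0r !mulr1.
      exact: schur_offdiag.
    rewrite (gdist_parents symE irrE connE cyc (o := o) _ rvw).
      by rewrite !exprS -/par mulr0n !(mulr0, addr0) mulrA.
    by rewrite -/(dep _) (eqP Lv) -/(dep _) (eqP Lw).
  - rewrite rmorph1 (gdist_parent_lt symE irrE connE cyc (o := o) (u := v)).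
      by rewrite exprS -/par mulr0n mulr1 !(mulr0, mul0r, addr0).
    by rewrite -/(dep v) -/(dep w) (eqP Lv) low.
  - rewrite conjr (gdist_sym symE connE v w).
    rewrite (gdist_parent_lt symE irrE connE cyc (o := o) (u := w)).
      by rewrite exprS -/par (gdist_sym symE connE v) mulr0n mul1r !(mulr0, mul0r, addr0).
    by rewrite -/(dep v) -/(dep w) (eqP Lw) low.
  - by rewrite rmorph1 mulr0n !(mulr0, mul0r, mul1r, addr0).
(* At this cutoff [Q N] agrees with the full kernel on all the given points. *)
pose N := \max_i dep (u i).
have := psdQ N n.+1 u c; congr (0 <= _).
apply: eq_bigr => i _; apply: eq_bigr => j _.
by rewrite /Q !leq_bigmax mul1r.
Qed.

End GammaKernel.

(** * The characterization by the interval *)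

Theorem theorem7p3 (R : realType) (a b : nat) (ha : (2 <= a)%N) (hb : (2 <= b)%N)
    (V : Type) (E : rel V) (hG : is_Gamma a b E) (x : R) :
  psd_kernel (fun u v : V => (x ^+ gdist E u v)%:C) <->
  x \in `[-1 / (b%:R - 1), 1].
Proof.
have b1 : 0 < b%:R - 1 :> R by rewrite subr_gt0 ltr1n.
have -> : (x \in `[-1 / (b%:R - 1), 1]) = (0 <= 1 + (b.-1)%:R * x) && (x <= 1).
  rewrite in_itv /= ler_pdivrMr // -subn1 natrB ?(ltnW hb) //.
  by congr (_ && _); apply/idP/idP; nra.
split=> [hQ|/andP[hx x1]].
  (* [{classic V}] endows the arbitrary type [V] with a choice structure. *)
  apply/andP; exact: (@Gamma_psd_bounds R {classic V} E a b hb hG x (ltnW ha)).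
exact: (@Gamma_psd R {classic V} E a b hb hG x).
Qed.
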